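(* Let $f:\mathbb{R}^n\to\mathbb{R}$, $g:\mathbb{R}^n\to(-\infty,\infty]$, $L>0$, $l\in\mathbb{R}$ and $\gamma>0$ satisfy the standing assumptions in the context, and let $\{(y^t,z^t,x^t)\}_{t\ge1}$ be any sequence generated by the Douglas-Rachford splitting method (defined in the context) with step-size parameter $\gamma$ from an initial point $x^0\in\mathbb{R}^n$. Suppose that $$(1+\gamma L)^2+\frac{5\gamma l}{2}-\frac32<0$$ and that the sequence $\{(y^t,z^t,x^t)\}$ has a cluster point $(y^*,z^*,x^* )$. Suppose in addition that $f$ and $g$ are semi-algebraic functions, so that the Douglas-Rachford merit function $\mathfrak{D}_\gamma$ (defined in the context) satisfies the Kurdyka-Łojasiewicz inequality at $(y^*,z^*,x^* )$ with $\psi(s)=c\,s^{1-\theta}$ for some $\theta\in[0,1)$ and $c>0$; that is, there exist $\nu\in(0,\infty]$ and a neighborhood $\mathcal{V}$ of $(y^*,z^*,x^* )$ such that, with $l^*=\mathfrak{D}_\gamma(y^*,z^*,x^* )$, $$c(1-\theta)\big(\mathfrak{D}_\gamma(y,z,x)-l^*\big)^{-\theta}\,\mathrm{dist}\big(0,\partial\mathfrak{D}_\gamma(y,z,x)\big)\ge1$$ for all $(y,z,x)\in\mathcal{V}$ with $l^*<\mathfrak{D}_\gamma(y,z,x)<l^*+\nu$. Then: (i) If $\theta=0$, then there exists $t_0\ge1$ such that for all $t\ge t_0$, $0\in\nabla f(z^t)+\partial g(z^t)$. (ii) If $\theta\in(0,\frac12]$, then there exist $\eta\in(0,1)$ and $\kappa>0$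 such that $\mathrm{dist}\big(0,\nabla f(z^t)+\partial g(z^t)\big)\le\kappa\,\eta^t$ for all large $t$. (iii) If $\theta\in(\frac12,1)$, then there exists $\kappa>0$ such that $\mathrm{dist}\big(0,\nabla f(z^t)+\partial g(z^t)\big)\le\kappa\,t^{-\frac1{4\theta-2}}$ for all large $t$.
   Context: Standing assumptions. $f:\mathbb{R}^n\to\mathbb{R}$ is continuously differentiable and $\nabla f$ is Lipschitz continuous with a Lipschitz modulus bounded by $L>0$. $l\in\mathbb{R}$ is such that $f+\frac l2\|\cdot\|^2$ is convex. $g:\mathbb{R}^n\to(-\infty,\infty]$ is proper (its domain $\{g<+\infty\}$ is nonempty) and closed (lower semicontinuous). For the given $\gamma>0$ and every $w\in\mathbb{R}^n$, the problem $\min_u\{\gamma g(u)+\frac12\|u-w\|^2\}$ has a minimizer. Douglas-Rachford splitting method. Given $x^0\in\mathbb{R}^n$ and $\gamma>0$, for $t=0,1,2,\dots$ choose $$y^{t+1}\in\operatorname{Arg\,min}_y\Big\{f(y)+\tfrac1{2\gamma}\|y-x^t\|^2\Big\},\quad z^{t+1}\in\operatorname{Arg\,min}_z\Big\{g(z)+\tfrac1{2\gamma}\|2y^{t+1}-x^t-z\|^2\Big\},\quad x^{t+1}=x^t+(z^{t+1}-y^{t+1}).$$ Douglas-Rachford merit function: $$\mathfrak{D}_\gamma(y,z,x)=f(y)+g(z)-\frac1{2\gamma}\|y-z\|^2+\frac1\gamma\langle x-y,z-y\rangle .$$ Subdifferential. For a proper function $h$ and $x$ with $h(x)<\infty$,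 $\partial h(x)$ is the limiting subdifferential: the set of $v$ for which there exist $x^k\to x$ with $h(x^k)\to h(x)$ and $v^k\to v$ such that $\liminf_{z\to x^k}\frac{h(z)-h(x^k)-\langle v^k,z-x^k\rangle}{\|z-x^k\|}\ge0$ for each $k$. Here $\mathrm{dist}(0,S)=\inf_{s\in S}\|s\|$, with $\mathrm{dist}(0,\emptyset)=+\infty$. Semi-algebraic. A set $S\subseteq\mathbb{R}^n$ is semi-algebraic if it is a finite union of sets of the form $\{x: h_1(x)=\dots=h_k(x)=0,\ g_1(x)<0,\dots,g_r(x)<0\}$ with real polynomials $h_i,g_j$. A function $F:\mathbb{R}^n\to(-\infty,\infty]$ is semi-algebraic if its graph $\{(x,F(x)): F(x)<\infty\}\subseteq\mathbb{R}^{n+1}$ is semi-algebraic. *)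

(* Defs.v *)
From mathcomp Require Import all_boot all_order all_algebra.
From mathcomp Require Import all_classical all_reals all_analysis.
(* The notations of mpoly conflict with those of mathcomp-analysis. *)
From mathcomp.multinomials Require Import(canonicals) mpoly.

Set Implicit Arguments.
Unset Strict Implicit.
Unset Printing Implicit Defensive.

Import Order.TTheory GRing.Theory Num.Theory.
Import numFieldNormedType.Exports.

Local Open Scope classical_set_scope.
Local Open Scope ring_scope.

(* R^n is 'rV[R]_n. The norm the library puts on 'rV[R]_n is the sup norm; it
   is used below only through the topology it induces. The Euclidean inner
   product and norm are [dot] and [enorm]. *)
Definition dot (R : realType) (n : nat) (u v : 'rV[R]_n) : R :=
  \sum_(i < n) u 0 i * v 0 i.

Definition enorm (R : realType) (n : nat) (u : 'rV[R]_n) : R :=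
  Num.sqrt (dot u u).

Definition grad (R : realType) (n : nat) (f : 'rV[R]_n -> R) (x : 'rV[R]_n) :
    'rV[R]_n :=
  \row_(i < n) 'D_(delta_mx 0 i) f x.

Definition continuously_differentiable (R : realType) (n : nat)
    (f : 'rV[R]_n -> R) : Prop :=
  (forall x, differentiable f x) /\ continuous (grad f).

Definition lipschitz_grad (R : realType) (n : nat) (f : 'rV[R]_n -> R)
    (L : R) : Prop :=
  forall x y, enorm (grad f x - grad f y) <= L * enorm (x - y).

Definition proper_fun (R : realType) (n : nat) (h : 'rV[R]_n -> \bar R) :
    Prop :=
  (forall x, h x != -oo%E) /\ (exists x, (h x < +oo)%E).

Definition argmin (R : realType) (n : nat) (h : 'rV[R]_n -> \bar R) :
    set 'rV[R]_n :=
  [set u | forall v, (h u <= h v)%E].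

(* Regular (Frechet) subgradients. The filter x^' is that of the punctured
   neighborhoods of x. *)
Definition regular_subdiff (R : realType) (n : nat) (h : 'rV[R]_n -> \bar R)
    (x : 'rV[R]_n) : set 'rV[R]_n :=
  [set v | (h x < +oo)%E /\
    (0 <= limf_einf
      (fun z => (h z - h x - (dot v (z - x))%:E) * ((enorm (z - x))^-1)%:E)
      x^')%E].

Definition limiting_subdiff (R : realType) (n : nat) (h : 'rV[R]_n -> \bar R)
    (x : 'rV[R]_n) : set 'rV[R]_n :=
  [set v | (h x < +oo)%E /\
    exists (xk vk : nat -> 'rV[R]_n),
      [/\ xk @ \oo --> x, h (xk k) @[k --> \oo] --> h x, vk @ \oo --> v &
          forall k, regular_subdiff h (xk k) (vk k)]].

Definition dist0 (R : realType) (n : nat) (S : set 'rV[R]_n) : \bar R :=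
  ereal_inf [set (enorm s)%:E | s in S].

Definition basic_semialgebraic (R : realType) (n : nat)
    (hs gs : seq (mpoly.mpoly n R)) : set 'rV[R]_n :=
  [set x | (forall h, h \in hs -> mpoly.meval (fun i => x 0 i) h = 0) /\
           (forall q, q \in gs -> mpoly.meval (fun i => x 0 i) q < 0)].

Definition semialgebraic_set (R : realType) (n : nat) (S : set 'rV[R]_n) :
    Prop :=
  exists s : seq (seq (mpoly.mpoly n R) * seq (mpoly.mpoly n R)),
    S = \bigcup_(p in [set` s]) basic_semialgebraic p.1 p.2.

(* A point of R^(n+1) is (x, a) = row_mx x a%:M. *)
Definition semialgebraic_fun (R : realType) (n : nat)
    (F : 'rV[R]_n -> \bar R) : Prop :=
  semialgebraic_set
    [set w : 'rV[R]_(n + 1) | exists (x : 'rV[R]_n) (a : R),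
       w = row_mx x a%:M /\ F x = a%:E].

(* The iterates y t and z t are meaningful for t >= 1 only: y 0 and z 0 are
   unconstrained. *)
Definition dr_sequence (R : realType) (n : nat) (f : 'rV[R]_n -> R)
    (g : 'rV[R]_n -> \bar R) (gamma : R) (x0 : 'rV[R]_n)
    (y z x : nat -> 'rV[R]_n) : Prop :=
  x 0%N = x0 /\ forall t : nat,
    [/\ argmin (fun u => (f u + (2 * gamma)^-1 * enorm (u - x t) ^+ 2)%:E)
          (y t.+1),
        argmin (fun u => g u +
                 ((2 * gamma)^-1 * enorm (2 *: y t.+1 - x t - u) ^+ 2)%:E)%E
          (z t.+1) &
        x t.+1 = x t + (z t.+1 - y t.+1)].

Definition dr_merit (R : realType) (n : nat) (f : 'rV[R]_n -> R)
    (g : 'rV[R]_n -> \bar R) (gamma : R) (y z x : 'rV[R]_n) : \bar R :=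
  ((f y)%:E + g z - ((2 * gamma)^-1 * enorm (y - z) ^+ 2)%:E
    + (gamma^-1 * dot (x - y) (z - y))%:E)%E.

(* Triples (y, z, x) are points of R^(3n), so that the subdifferential of the
   merit function and distances are taken in the Euclidean space R^(3n). *)
Definition pack3 (R : realType) (n : nat) (y z x : 'rV[R]_n) :
    'rV[R]_(n + n + n) :=
  row_mx (row_mx y z) x.

Definition dr_merit3 (R : realType) (n : nat) (f : 'rV[R]_n -> R)
    (g : 'rV[R]_n -> \bar R) (gamma : R) (w : 'rV[R]_(n + n + n)) : \bar R :=
  dr_merit f g gamma (lsubmx (lsubmx w)) (rsubmx (lsubmx w)) (rsubmx w).

(* Kurdyka-Lojasiewicz inequality at ws with psi(s) = c * s^(1 - theta),
   psi'(s) = c * (1 - theta) * s^(- theta). If h never takes the value -oo,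
   then h ws < h w < h ws + nu makes h ws and h w finite, so that [fine] loses
   nothing. *)
Definition kl_inequality (R : realType) (n : nat) (h : 'rV[R]_n -> \bar R)
    (ws : 'rV[R]_n) (c theta : R) : Prop :=
  exists (nu : \bar R) (V : set 'rV[R]_n),
    [/\ (0 < nu)%E, nbhs ws V &
        forall w, V w -> (h ws < h w)%E -> (h w < h ws + nu)%E ->
          (1 <= (c * (1 - theta) * fine (h w - h ws) `^ (- theta))%:E
                * dist0 (limiting_subdiff h w))%E].

Definition stationarity_set (R : realType) (n : nat) (f : 'rV[R]_n -> R)
    (g : 'rV[R]_n -> \bar R) (z : 'rV[R]_n) : set 'rV[R]_n :=
  [set grad f z + v | v in limiting_subdiff g z].

(* Main.v *)
Require Import Defs.
From mathcomp Require Import all_boot all_order all_algebra.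
From mathcomp Require Import all_classical all_reals all_analysis.
From mathcomp Require Import zify ring lra.

Import Order.TTheory GRing.Theory Num.Theory.
Import numFieldNormedType.Exports.

Local Open Scope classical_set_scope.
Local Open Scope ring_scope.

(** The proof follows the merit function along the iterates. Write [D t] for its
    value at [(y t, z t, x t)] and [delta t] for the length of the step from
    [y t] to [y t.+1].

    Three facts about the method carry everything.  The optimality condition of
    the [y]-step gives [x t = y t.+1 + gamma * grad f (y t.+1)], so the
    displacement of [x], which equals [z t - y t], is at most
    [(1 + gamma * L) * delta t] ([dx_le]).  Secondly [D] drops by at least
    [a * delta t ^+ 2] at each step, where [a > 0] is precisely the step-size
    condition ([merit_decrease]).  Thirdly, the optimality conditions exhibit
    an element of the subdifferential of the merit function at
    [(y t, z t, x t)], and an element of [grad f (z t) + subdiff g (z t)],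
    both of norm [O(delta t)] ([merit_subgradient_le],
    [stationarity_residual]).  It is thus enough to bound [delta t].

    At a cluster point, lower semicontinuity of [g] and the minimality of
    [z t] show that [D t] decreases to the value [D*] of the merit function at
    that point ([merit_cluster_le], [merit_small]).  Put [e t = D t - D*].

    What remains concerns real sequences ([kl_descent_rates]).  The
    Kurdyka-Lojasiewicz inequality reads [e t `^ theta <= M * delta t] as long
    as the iterates are near the cluster point.  Because it bounds the next
    step from below, concavity of [s `^ (1 - theta)] makes [delta t] bounded by
    a telescoping difference; the total length travelled is then small, and the
    iterates never leave the neighborhood where the inequality holds
    ([kl_step], [kl_trap]).  Inserting the inequality in the decrease of [e]
    gives [e t.+1 <= e t - b * e t `^ (2 * theta)].  For [theta = 0] this
    cannot go on forever, so [e] vanishes and the method stops; for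
    [theta <= 1 / 2] it is a geometric decay; for [theta > 1 / 2] the sequence
    [e t `^ (1 - 2 * theta)] grows at least linearly.  In every case
    [a * delta t ^+ 2 <= e t] turns the rate of [e] into the rate of
    [delta]. *)

(** * Euclidean inner product and norm *)

Section euclidean.
Context {R : realType} {n : nat}.
Implicit Types (u v w : 'rV[R]_n) (a : R).

Lemma dotC u v : dot u v = dot v u.
Proof. by apply: eq_bigr => i _; rewrite mulrC. Qed.

Lemma dotDl u v w : dot (u + v) w = dot u w + dot v w.
Proof. by rewrite /dot -big_split; apply: eq_bigr => i _; rewrite mxE mulrDl. Qed.

Lemma dotZl a u v : dot (a *: u) v = a * dot u v.
Proof. by rewrite /dot mulr_sumr; apply: eq_bigr => i _; rewrite mxE mulrA. Qed.

Lemma dotNl u v : dot (- u) v = - dot u v.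
Proof. by rewrite -scaleN1r dotZl mulN1r. Qed.

Lemma dotDr u v w : dot w (u + v) = dot w u + dot w v.
Proof. by rewrite dotC dotDl !(dotC w). Qed.

Lemma dotZr a u v : dot u (a *: v) = a * dot u v.
Proof. by rewrite dotC dotZl dotC. Qed.

Lemma dotNr u v : dot u (- v) = - dot u v.
Proof. by rewrite dotC dotNl dotC. Qed.

Lemma dot0l v : dot 0 v = 0.
Proof. by rewrite -(scale0r 0) dotZl mul0r. Qed.

Definition dotE := (dotDl, dotDr, dotNl, dotNr, dotZl, dotZr).

Lemma dot_ge0 u : 0 <= dot u u.
Proof. by apply: sumr_ge0 => i _; rewrite -expr2 sqr_ge0. Qed.

Lemma dot_eq0 u : (dot u u == 0) = (u == 0).
Proof.
apply/idP/eqP => [|->]; last by rewrite dot0l.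
rewrite psumr_eq0 => [|i _]; last by rewrite -expr2 sqr_ge0.
move=> /allP u0; apply/rowP => i; rewrite mxE; apply/eqP.
by rewrite -[_ == _]orbb -mulf_eq0; apply: u0; rewrite mem_index_enum.
Qed.

Lemma enorm_ge0 u : 0 <= enorm u.
Proof. exact: sqrtr_ge0. Qed.

Lemma sqr_enorm u : enorm u ^+ 2 = dot u u.
Proof. by rewrite sqr_sqrtr// dot_ge0. Qed.

Lemma enorm_eq0 u : (enorm u == 0) = (u == 0).
Proof. by rewrite -dot_eq0 -sqr_enorm sqrf_eq0. Qed.

Lemma enorm0 : enorm (0 : 'rV[R]_n) = 0.
Proof. by apply/eqP; rewrite enorm_eq0. Qed.

Lemma enorm_gt0 u : (0 < enorm u) = (u != 0).
Proof. by rewrite lt_def enorm_eq0 enorm_ge0 andbT. Qed.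

Lemma enormN u : enorm (- u) = enorm u.
Proof. by rewrite /enorm dotNl dotNr opprK. Qed.

Lemma enormZ a u : enorm (a *: u) = `|a| * enorm u.
Proof. by rewrite /enorm dotZl dotZr mulrA -expr2 sqrtrM ?sqr_ge0// sqrtr_sqr. Qed.

Lemma le_enorm u (b : R) : 0 <= b -> dot u u <= b ^+ 2 -> enorm u <= b.
Proof. by move=> b0; rewrite -sqr_enorm ler_pXn2r// nnegrE ?enorm_ge0. Qed.

Lemma cauchy_schwarz u v : dot u v <= enorm u * enorm v.
Proof.
have [->|u0] := eqVneq u 0; first by rewrite dot0l enorm0 mul0r.
have [->|v0] := eqVneq v 0; first by rewrite dotC dot0l enorm0 mulr0.
(* Expanding the square of this vector yields twice
   [enorm u * enorm v * (enorm u * enorm v - dot u v)]. *)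
have := dot_ge0 (enorm v *: u - enorm u *: v).
rewrite !dotE -!sqr_enorm (dotC v u).
move: u0 v0; rewrite -!enorm_gt0; move: (enorm u) (enorm v) => p q p0 q0.
have pq0 : 0 < p * q by rewrite mulr_gt0.
move=> h; rewrite -(ler_pM2l pq0); nra.
Qed.

Lemma enorm_triangle u v : enorm (u + v) <= enorm u + enorm v.
Proof.
apply: le_enorm; first by rewrite addr_ge0 ?enorm_ge0.
rewrite !dotE -!sqr_enorm (dotC v u); have := cauchy_schwarz u v; nra.
Qed.

(** The topology of ['rV[R]_n] is that of the sup norm.  This comparison and the
    next one let neighborhoods be described by Euclidean balls. *)
Lemma normr_le_enorm u : `|u| <= enorm u.
Proof.
rewrite [leLHS]/Num.norm/= mx_normrE; apply/bigmax_leP; split=> [|[i j] _ /=].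
  exact: enorm_ge0.
rewrite ord1 -sqrtr_sqr ler_wsqrtr// /dot (bigD1 j)//= -expr2 lerDl.
by apply: sumr_ge0 => k _; rewrite -expr2 sqr_ge0.
Qed.

Lemma enorm_le_normr u : enorm u <= n%:R * `|u|.
Proof.
apply: le_enorm; first by rewrite mulr_ge0.
have ui i : `|u 0 i| <= `|u|.
  rewrite [leRHS]/Num.norm/= mx_normrE.
  by apply/bigmax_geP; right; exists (0, i).
have : dot u u <= \sum_(i < n) `|u| ^+ 2.
  apply: ler_sum => i _; rewrite -expr2 -real_normK ?num_real//.
  by rewrite ler_pXn2r// nnegrE.
move=> /le_trans; apply; rewrite sumr_const card_ord -[leLHS]mulr_natl exprMn.
rewrite ler_wpM2r ?sqr_ge0// -natrX ler_nat.
by case: (n) => // m; rewrite expnS leq_pmulr// expn_gt0.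
Qed.

Lemma near_enorm_lt v (e : R) : 0 < e -> \forall u \near v, enorm (u - v) < e.
Proof.
move=> e0; have d0 : 0 < e / n.+1%:R by rewrite divr_gt0.
apply/nbhs_normP; exists (e / n.+1%:R) => //= u /=; rewrite distrC => uv.
rewrite (le_lt_trans (enorm_le_normr _))//.
rewrite ltr_pdivlMr// in uv; apply: le_lt_trans uv; rewrite mulrC.
by rewrite ler_wpM2l// ler_nat.
Qed.

Lemma nbhs_enorm v (V : set 'rV[R]_n) : nbhs v V ->
  exists2 e : R, 0 < e & forall u, enorm (u - v) < e -> V u.
Proof.
move=> /nbhs_normP[e /= e0 eV]; exists e => // u uv; apply: eV => /=.
by rewrite distrC; exact: le_lt_trans (normr_le_enorm _) uv.
Qed.

End euclidean.

Section pack.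
Context {R : realType}.

Lemma dot_row_mx m n (a c : 'rV[R]_m) (b d : 'rV[R]_n) :
  dot (row_mx a b) (row_mx c d) = dot a c + dot b d.
Proof.
rewrite /dot big_split_ord/=; congr (_ + _); apply: eq_bigr => i _.
  by rewrite !row_mxEl.
by rewrite !row_mxEr.
Qed.

Lemma dot_pack3 n (a b c a' b' c' : 'rV[R]_n) :
  dot (pack3 a b c) (pack3 a' b' c') = dot a a' + dot b b' + dot c c'.
Proof. by rewrite !dot_row_mx. Qed.

Lemma pack3B n (a b c a' b' c' : 'rV[R]_n) :
  pack3 a b c - pack3 a' b' c' = pack3 (a - a') (b - b') (c - c').
Proof. by rewrite /pack3 !opp_row_mx !add_row_mx. Qed.

Lemma pack3_surj n (w : 'rV[R]_(n + n + n)) :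
  w = pack3 (lsubmx (lsubmx w)) (rsubmx (lsubmx w)) (rsubmx w).
Proof. by rewrite /pack3 !hsubmxK. Qed.

Lemma dr_merit3E n (f : 'rV[R]_n -> R) g gamma a b c :
  dr_merit3 f g gamma (pack3 a b c) = dr_merit f g gamma a b c.
Proof. by rewrite /dr_merit3 /pack3 !(row_mxKl, row_mxKr). Qed.

Lemma enorm_pack3 n (a b c : 'rV[R]_n) :
  enorm (pack3 a b c) ^+ 2 = enorm a ^+ 2 + enorm b ^+ 2 + enorm c ^+ 2.
Proof. by rewrite !sqr_enorm dot_pack3. Qed.

Lemma enorm_pack3_le n (a b c : 'rV[R]_n) :
  enorm (pack3 a b c) <= enorm a + enorm b + enorm c.
Proof.
have := enorm_ge0 a; have := enorm_ge0 b; have := enorm_ge0 c => c0 b0 a0.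
apply: le_enorm; first by rewrite !addr_ge0.
by rewrite -sqr_enorm enorm_pack3; nra.
Qed.

End pack.

(** * Gradients and weak convexity *)

Section smooth.
Context {R : realType} {n : nat}.
Implicit Types (f : 'rV[R]_n -> R) (u v y : 'rV[R]_n).

Lemma derive_grad f y v : differentiable f y -> 'D_v f y = dot (grad f y) v.
Proof.
move=> df; rewrite deriveE// [in LHS](row_sum_delta v) linear_sum /dot.
by apply: eq_bigr => i _; rewrite linearZ/= mxE deriveE// mulrC.
Qed.

(** First-order conditions are read off from upper bounds of the difference
    quotients on one side: only small positive [t] matter, and the term
    [b * t] disappears in the limit. *)
Lemma derive_le f y v (a b : R) : differentiable f y ->
  (forall t : R, 0 < t < 1 -> f (y + t *: v) - f y <= t * (a + b * t)) ->
  dot (grad f y) v <= a.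
Proof.
move=> df fle; rewrite -derive_grad//.
have fv : derivable f y v by exact: diff_derivable.
apply/ler_addgt0Pr => e e0.
have cv : (fun h => h^-1 *: ((f \o shift y) (h *: v) - f y)) @ 0^'+ -->
    'D_v f y by exact: cvg_dnbhs_at_right fv.
rewrite -(cvg_lim _ cv)//; apply: limr_le; first by apply/cvg_ex; eexists; exact: cv.
have k0 : 0 < e / (`|b| + 1) by rewrite divr_gt0// ltr_wpDl.
near=> t.
have t0 : 0 < t by near: t; exact: nbhs_right_gt.
have t1 : t < 1 by near: t; exact: nbhs_right_lt.
have te : t < e / (`|b| + 1) by near: t; exact: nbhs_right_lt.
rewrite ltr_pdivlMr ?ltr_wpDl// in te.
rewrite /= -[_ *: _]/(t^-1 * _) mulrC ler_pdivrMr// addrC (addrC (t *: v)).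
rewrite addrC (le_trans (fle t _)) ?t0//  mulrC ler_pM2r// lerD2l.
rewrite (le_trans (ler_norm _))// normrM (gtr0_norm t0); nra.
Unshelve. all: by end_near. Qed.

End smooth.

Section weakly_convex.
Context {R : realType} {n : nat} (f : 'rV[R]_n -> R) (l : R).
Hypothesis f_diff : forall u, differentiable f u.
Hypothesis f_cvx : convex_function [set: convex_lmodType 'rV[R]_n]
  (fun u : 'rV[R]_n => f u + l / 2 * enorm u ^+ 2).

(** The gradient inequality of the convex function [f + l / 2 * |.|^2], in
    which the quadratic terms recombine into the square of [v - u].  It is the
    only form in which the convexity assumption is used. *)
Lemma weakly_convex_grad u v :
  f u + dot (grad f u) (v - u) - l / 2 * dot (v - u) (v - u) <= f v.
Proof.
suff : dot (grad f u) (v - u) <= f v - f u + l / 2 * dot (v - u) (v - u) by lra.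
apply: (derive_le _ _ _ _ (- (l / 2 * dot (v - u) (v - u)))) => // t /andP[t0 t1].
pose F w := f w + l / 2 * enorm w ^+ 2.
have : F (t *: v + (1 - t) *: u) <= t * F v + (1 - t) * F u.
  by apply: (f_cvx (Itv01 (ltW t0) (ltW t1)) v u); rewrite inE.
rewrite {}/F.
have -> : t *: v + (1 - t) *: u = u + t *: (v - u).
  by rewrite scalerBl scale1r scalerBr addrCA addrA.
rewrite !sqr_enorm !dotE (dotC v u); nra.
Qed.

Lemma grad_monotone u v :
  - l * dot (v - u) (v - u) <= dot (grad f v - grad f u) (v - u).
Proof.
have := weakly_convex_grad u v; have := weakly_convex_grad v u.
rewrite -(opprB v u) !dotE; lra.
Qed.

End weakly_convex.

(** Fermat's rule for the proximal step on [f]: moving from the minimizer [y]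
    in the direction opposite to the residual cannot decrease the objective,
    so the square of the residual is nonpositive. *)
Lemma prox_grad {R : realType} {n : nat} (f : 'rV[R]_n -> R) (gamma : R)
    (x y : 'rV[R]_n) : differentiable f y ->
  argmin (fun u => (f u + (2 * gamma)^-1 * enorm (u - x) ^+ 2)%:E) y ->
  grad f y = gamma^-1 *: (x - y).
Proof.
move=> df fmin; apply/eqP; rewrite -subr_eq0 -dot_eq0.
set d := grad f y - _; rewrite eq_le dot_ge0 andbT.
have df' : differentiable (- f) y by exact: differentiableN.
have gradN : grad (- f) y = - grad f y.
  by apply/rowP => i; rewrite !mxE deriveN//; exact: diff_derivable.
have min_dir e : dot (grad (- f) y) (- e) <= - (gamma^-1 * dot (y - x) e).
  apply: (derive_le _ _ _ _ ((2 * gamma)^-1 * dot e e)) => // t /andP[t0 _].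
  have := fmin (y + t *: - e); rewrite lee_fin.
  have -> : y + t *: - e - x = (y - x) - t *: e by rewrite scalerN addrAC.
  rewrite /= -[(- f) _]/(- f _) -[(- f) y]/(- f y).
  rewrite !sqr_enorm invfM !dotE (dotC e y) (dotC e x); nra.
have := min_dir d; rewrite gradN /d !dotE; lra.
Qed.

(** * Tangents of real powers *)

Section real_powers.
Context {R : realType}.
Implicit Types (p q r u v : R).

(** A concave power lies below its tangents.  After scaling to [v = 1] this is
    a convexity inequality for [expR] between [0] and [ln (u / v)], obtained
    from the tangent of [expR] at [q * ln (u / v)]. *)
Lemma powR_tangent_concave q u v : 0 <= q <= 1 -> 0 < u -> 0 < v ->
  u `^ q <= v `^ q + q * v `^ (q - 1) * (u - v).
Proof.
move=> /andP[q0 q1] u0 v0.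
have r0 : 0 < u / v by rewrite divr_gt0.
have tangent1 : (u / v) `^ q <= 1 + q * (u / v - 1).
  rewrite /powR gt_eqF//; set s := q * ln (u / v).
  have exp_tangent (z : R) : expR s * (1 + (z - s)) <= expR z.
    have -> : expR z = expR s * expR (z - s) by rewrite -expRD; congr expR; ring.
    by rewrite ler_pM2l ?expR_gt0// expR_ge1Dx.
  have := exp_tangent (ln (u / v)); have := exp_tangent 0.
  rewrite expR0 lnK ?posrE//.
  have : q * ln (u / v) - s = 0 by rewrite subrr.
  move: (ln _) (s) (expR s) => L {exp_tangent s} s E sE h0 h1.
  have -> : E = q * (E * (1 + (L - s))) + (1 - q) * (E * (1 + (0 - s))).
    transitivity (E + E * (q * L - s)); last by ring.
    by rewrite sE mulr0 addr0.
  nra.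
have -> : u `^ q = (u / v) `^ q * v `^ q.
  by rewrite -powRM ?divfK ?gt_eqF ?ltW.
rewrite powRB ?(gt_eqF v0) ?implybT// powRr1 ?(ltW v0)//.
apply: (le_trans (ler_wpM2r (powR_ge0 v q) tangent1)).
by rewrite le_eqVlt; apply/orP; left; apply/eqP; field; rewrite gt_eqF.
Qed.

(** A negative power lies above its tangents: after scaling to [v = 1],
    [expR] and [ln] are compared with their tangents at [0] and [1]. *)
Lemma powR_tangent_convex p u v : 0 <= p -> 0 < u -> 0 < v ->
  v `^ (- p) + p * v `^ (- p - 1) * (v - u) <= u `^ (- p).
Proof.
move=> p0 u0 v0.
have r0 : 0 < u / v by rewrite divr_gt0.
have tangent1 : 1 - p * (u / v - 1) <= (u / v) `^ (- p).
  rewrite /powR gt_eqF//; apply: le_trans (expR_ge1Dx _).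
  rewrite mulNr lerD2l lerN2 ler_wpM2l//.
  by have := @le_ln1Dx R (u / v - 1); rewrite subrKC; apply; lra.
have -> : u `^ (- p) = (u / v) `^ (- p) * v `^ (- p).
  by rewrite -powRM ?divfK ?gt_eqF ?ltW.
rewrite powRB ?(gt_eqF v0) ?implybT// powRr1 ?(ltW v0)//.
apply: le_trans (ler_wpM2r (powR_ge0 v (- p)) tangent1).
by rewrite le_eqVlt; apply/orP; left; apply/eqP; field; rewrite gt_eqF.
Qed.

End real_powers.

(** * Decay of sequences and the Kurdyka-Lojasiewicz inequality *)

Section decay.
Context {R : realType}.
Implicit Types (e : nat -> R) (b p : R) (N : nat).

(** The conclusion is phrased with the square of [eta ^+ t] because [e] will
    control the square of the step. *)
Lemma geometric_decay e b N : 0 < b ->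
  (forall t, (N <= t)%N -> 0 < e t /\ e t.+1 <= (1 - b) * e t) ->
  exists eta C : R, [/\ 0 < eta < 1, 0 < C &
    forall t, (N <= t)%N -> e t <= C * (eta ^+ t) ^+ 2].
Proof.
move=> b0 eb; have [eN_gt0 eNS] := eb _ (leqnn N).
have b1 : b < 1.
  by have := eNS; have [] := eb N.+1 (leqnSn N); nra.
pose eta := Num.sqrt (1 - b).
have eta2 : eta ^+ 2 = 1 - b by rewrite sqr_sqrtr// subr_ge0 ltW.
have eta0 : 0 < eta by rewrite sqrtr_gt0 subr_gt0.
have etaN0 : 0 < (eta ^+ N) ^+ 2 by rewrite !exprn_gt0.
exists eta, (e N / (eta ^+ N) ^+ 2); split.
- by rewrite eta0/=; nra.
- by rewrite divr_gt0.
- move=> t /subnK <-; elim: (t - N)%N => [|k IH]; first by rewrite divfK ?gt_eqF.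
  rewrite addSn [eta ^+ _.+1]exprS exprMn eta2.
  have [_ step] := eb (k + N)%N (leq_addl _ _); apply: le_trans step _.
  by rewrite mulrCA ler_wpM2l// subr_ge0 ltW.
Qed.

(** The substitution [s = e `^ (- p)] linearizes the recursion: by convexity of
    the negative power, [s] increases by at least [p * b] at each step. *)
Lemma power_decay e b p N : 0 < b -> 0 < p ->
  (forall t, (N <= t)%N -> 0 < e t /\ e t.+1 <= e t - b * e t `^ (1 + p)) ->
  exists2 C : R, 0 < C &
    forall t, (N.*2.+1 <= t)%N -> e t <= C * t%:R `^ (- p^-1).
Proof.
move=> b0 p0 eb.
have growth k : p * b * k%:R <= e (k + N)%N `^ (- p).
  elim: k => [|k IH]; first by rewrite mulr0 powR_ge0.
  have [v0 uv] := eb (k + N)%N (leq_addl _ _).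
  have [u0 _] := eb (k.+1 + N)%N (leq_addl _ _).
  apply: le_trans (powR_tangent_convex p _ _ (ltW p0) u0 v0).
  rewrite -natr1 mulrDr mulr1 lerD// -mulrA ler_wpM2l ?(ltW p0)//.
  rewrite addSn; move: (e (k + N).+1) (e (k + N)%N) v0 uv => u v v0 uv.
  have -> : b = v `^ (- p - 1) * (b * v `^ (1 + p)).
    rewrite mulrCA -powRD; last by rewrite (gt_eqF v0) implybT.
    by rewrite (_ : - p - 1 + (1 + p) = 0) ?powRr0 ?mulr1//; ring.
  by rewrite ler_wpM2l ?powR_ge0// lerBrDl addrC -lerBrDl.
pose m := p * b / 2; have m0 : 0 < m by rewrite divr_gt0// mulr_gt0.
exists (m^-1 `^ p^-1); first by rewrite powR_gt0// invr_gt0.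
(* Past twice the starting index, [t - N] is at least [t / 2]; hence the
   factor [1 / 2] in [m]. *)
move=> t tN; have t0 : 0 < t%:R :> R by rewrite ltr0n; case: t tN.
have Nt : (N <= t)%N by rewrite (leq_trans _ tN)// -addnn -addnS leq_addr.
have [et0 _] := eb t Nt.
have : m * t%:R <= e t `^ (- p).
  rewrite -[in e t](subnK Nt); apply: le_trans (growth _).
  rewrite /m -mulrA ler_wpM2l ?mulr_ge0 ?(ltW p0) ?(ltW b0)//.
  rewrite ler_pdivrMl// -natrM ler_nat mul2n -addnn.
  by rewrite -leq_subLR leq_sub2l//; rewrite -addnn in tN; lia.
rewrite powRN => h.
have ep : e t `^ p <= m^-1 * t%:R^-1.
  by rewrite -invfM -[leLHS]invrK lef_pV2// posrE ?invr_gt0 ?powR_gt0// mulr_gt0.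
have -> : e t = (e t `^ p) `^ p^-1.
  by rewrite -powRrM mulfV ?gt_eqF// powRr1// ltW.
have -> : t%:R `^ (- p^-1) = (t%:R^-1) `^ p^-1 :> R.
  by rewrite -[in RHS]powR_inv1 ?(ltW t0)// -powRrM mulN1r.
rewrite -powRM ?invr_ge0 ?(ltW m0) ?(ltW t0)//; apply: ge0_ler_powR => //.
- by rewrite invr_ge0 ltW.
- by rewrite nnegrE powR_ge0.
- by rewrite nnegrE mulr_ge0// invr_ge0 ltW.
Qed.

End decay.

(** In this section [e] plays the part of the objective value minus its limit,
    [delta] that of the step length and [d] that of the distance to a cluster
    point. *)
Section kl_descent.
Context {R : realType} (a K theta : R) (d e delta : nat -> R) (N : nat).
Hypothesis a_gt0 : 0 < a.
Hypothesis K_gt0 : 0 < K.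
Hypothesis theta_ge0 : 0 <= theta.
Hypothesis theta_lt1 : theta < 1.
Hypothesis delta_ge0 : forall t, 0 <= delta t.
Hypothesis e_ge0 : forall t, (N <= t)%N -> 0 <= e t.
Hypothesis e_decrease : forall t, (N <= t)%N ->
  e t.+1 <= e t - a * delta t ^+ 2.
Hypothesis e_small : forall eps : R, 0 < eps ->
  exists2 t, (N <= t)%N & e t < eps.

Lemma value_nonincreasing s t : (N <= s)%N -> (s <= t)%N -> e t <= e s.
Proof.
move=> Ns /subnK <-; elim: (t - s)%N => [//|k IH].
apply: le_trans IH; apply: le_trans (e_decrease _ _) _.
  by rewrite (leq_trans Ns)// leq_addl.
by rewrite gerBl mulr_ge0 ?sqr_ge0// ltW.
Qed.

Lemma value_eventually_small (eps : R) : 0 < eps -> exists N0, (N <= N0)%N /\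
  forall t, (N0 <= t)%N -> e t < eps.
Proof.
move=> /e_small[s Ns es]; exists s; split=> // t st.
exact: le_lt_trans (value_nonincreasing _ _ Ns st) es.
Qed.

Lemma sqr_step_le t : (N <= t)%N -> a * delta t ^+ 2 <= e t.
Proof.
move=> Nt; have := e_decrease _ Nt; have := e_ge0 _ (leq_trans Nt (leqnSn t)).
lra.
Qed.

Lemma step_le_sqrt t (C X : R) : (N <= t)%N -> 0 <= C -> 0 <= X ->
  e t <= C * X ^+ 2 -> delta t <= Num.sqrt (C / a) * X.
Proof.
move=> Nt C0 X0 eC.
rewrite -(@ler_pXn2r _ 2)// ?nnegrE ?mulr_ge0 ?sqrtr_ge0//.
rewrite exprMn sqr_sqrtr ?divr_ge0 ?(ltW a_gt0)//.
rewrite mulrAC ler_pdivlMr// mulrC (le_trans (sqr_step_le _ Nt))//.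
Qed.

Lemma step_eventually_small (eps : R) : 0 < eps -> exists N0, (N <= N0)%N /\
  forall t, (N0 <= t)%N -> delta t < eps.
Proof.
move=> eps0; have : 0 < a * eps ^+ 2 by rewrite mulr_gt0 ?exprn_gt0.
move=> /value_eventually_small[N0 [NN0 eN0]]; exists N0; split=> // t N0t.
have := le_lt_trans (sqr_step_le _ (leq_trans NN0 N0t)) (eN0 t N0t).
by rewrite ltr_pM2l// ltr_pXn2r// nnegrE ?delta_ge0// ltW.
Qed.

(** KL against the next step telescopes *)
(** The subgradient at time [t] is controlled by the step that starts at time
    [t], which is also the step in the decrease of [e].  The usual square-root
    averaging over two consecutive steps is therefore avoided, and the bound
    telescopes directly. *)
Lemma kl_step t : (N <= t)%N -> 0 < e t -> 0 < e t.+1 ->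
  1 <= K * (1 - theta) * e t `^ (- theta) * delta t ->
  a * delta t <= K * (e t `^ (1 - theta) - e t.+1 `^ (1 - theta)).
Proof.
move=> Nt et eSt kl.
have q01 : 0 <= 1 - theta <= 1 by rewrite subr_ge0 ltW// gerBl.
have := powR_tangent_concave (1 - theta) _ _ q01 eSt et.
rewrite (_ : 1 - theta - 1 = - theta); last by ring.
move: (e t `^ (- theta)) kl (powR_ge0 (e t) (- theta)) => w kl w0.
have := e_decrease _ Nt; have := delta_ge0 t.
move: (delta t) kl (e t) (e t.+1) (e t.+1 `^ (1 - theta)) (e t `^ (1 - theta)).
move=> D kl v u P Q D0 uv tg.
have h1 : (1 - theta) * w * (a * D ^+ 2) <= Q - P.
  rewrite lerBrDr -lerBrDl; apply: le_trans tg _.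
  rewrite lerD2l -mulrN ler_wpM2l//; last by lra.
  by rewrite mulr_ge0//; lra.
apply: le_trans (ler_wpM2l (ltW K_gt0) h1).
have : a * D * 1 <= a * D * (K * (1 - theta) * w * D).
  by rewrite ler_wpM2l// mulr_ge0// ltW.
rewrite mulr1 => /le_trans; apply.
by rewrite le_eqVlt; apply/orP; left; apply/eqP; ring.
Qed.

Hypothesis e_gt0 : forall t, (N <= t)%N -> 0 < e t.

(** Once [d] and [e] are small enough at one index [t0], the quantity
    [a * d t + K * e t `^ (1 - theta)] is nonincreasing from there on: the
    travelled distance is paid for by the decrease of [e `^ (1 - theta)].  Its
    initial value is below [a * rho], so [d] stays below [rho]. *)
Lemma kl_trap (rho : R) : 0 < rho ->
  (forall t, (N <= t)%N -> d t.+1 <= d t + delta t) ->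
  (forall (eps : R) N0, 0 < eps -> exists2 t, (N0 <= t)%N & d t < eps) ->
  (forall t, (N <= t)%N -> d t < rho -> delta t < rho -> e t < rho ->
    1 <= K * (1 - theta) * e t `^ (- theta) * delta t) ->
  exists N0, (N <= N0)%N /\ forall t, (N0 <= t)%N ->
    1 <= K * (1 - theta) * e t `^ (- theta) * delta t.
Proof.
move=> rho0 d_step d_small kl.
have q0 : 0 < 1 - theta by rewrite subr_gt0.
(* [K * mu] is half of [a * rho]; the other half is left for [a * d t0]. *)
pose mu := a * rho / (2 * K).
have mu0 : 0 < mu by rewrite divr_gt0 ?mulr_gt0.
have [N1 [NN1 eN1]] := value_eventually_small _ rho0.
have [N2 [NN2 dN2]] := step_eventually_small _ rho0.
have [N3 [NN3 eN3]] := value_eventually_small _ (powR_gt0 (1 - theta)^-1 mu0).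
have rho2 : 0 < rho / 2 by rewrite divr_gt0.
have [t0 t0N dt0] := d_small _ (maxn N1 (maxn N2 N3)) rho2.
move: t0N; rewrite !geq_max => /and3P[N1t0 N2t0 N3t0].
have Nt0 : (N <= t0)%N := leq_trans NN1 N1t0.
have budget : K * e t0 `^ (1 - theta) < a * (rho / 2).
  have : e t0 `^ (1 - theta) < (mu `^ (1 - theta)^-1) `^ (1 - theta).
    by apply: gt0_ltr_powR; rewrite ?nnegrE ?powR_ge0 ?eN3 ?e_ge0.
  rewrite -powRrM mulVf ?gt_eqF// powRr1 ?(ltW mu0)// -(ltr_pM2l K_gt0).
  move=> /lt_le_trans; apply; rewrite le_eqVlt /mu; apply/orP; left; apply/eqP.
  by field; rewrite gt_eqF.
have close t : (t0 <= t)%N -> a * d t + K * e t `^ (1 - theta)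
    <= a * d t0 + K * e t0 `^ (1 - theta) -> d t < rho.
  move=> t0t dt; have : 0 <= K * e t `^ (1 - theta).
    by rewrite mulr_ge0 ?powR_ge0// ltW.
  by move: dt0; rewrite -(ltr_pM2l a_gt0) -[d t < _](ltr_pM2l a_gt0); lra.
have kl_close t : (t0 <= t)%N -> a * d t + K * e t `^ (1 - theta)
    <= a * d t0 + K * e t0 `^ (1 - theta) ->
    1 <= K * (1 - theta) * e t `^ (- theta) * delta t.
  move=> t0t /(close _ t0t) dt; apply: kl => //.
  - exact: leq_trans t0t.
  - exact: dN2 (leq_trans N2t0 t0t).
  - exact: eN1 (leq_trans N1t0 t0t).
have invariant k : a * d (k + t0)%N + K * e (k + t0)%N `^ (1 - theta)
    <= a * d t0 + K * e t0 `^ (1 - theta).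
  elim: k => [//|k IH]; apply: le_trans (IH).
  have t0s : (t0 <= k + t0)%N by exact: leq_addl.
  move: (k + t0)%N t0s IH (addSn k t0) => s t0s IH ->.
  have Ns : (N <= s)%N := leq_trans Nt0 t0s.
  have := kl_step _ Ns (e_gt0 _ Ns) (e_gt0 _ (leq_trans Ns (leqnSn s)))
    (kl_close _ t0s IH).
  have := d_step s Ns; rewrite -(ler_pM2l a_gt0); lra.
exists t0; split=> // t t0t; apply: kl_close => //.
by have := invariant (t - t0)%N; rewrite subnK.
Qed.

End kl_descent.

(** Either [e] reaches [0], and then no step is made any more, or the
    Kurdyka-Lojasiewicz inequality holds from some index on and closes the
    recursion for [e]. *)
Lemma kl_descent_rates {R : realType} (a K theta rho : R) (d e delta : nat -> R)
    (N : nat) :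
  0 < a -> 0 < K -> 0 <= theta -> theta < 1 -> 0 < rho ->
  (forall t, 0 <= delta t) ->
  (forall t, (N <= t)%N -> 0 <= e t) ->
  (forall t, (N <= t)%N -> e t.+1 <= e t - a * delta t ^+ 2) ->
  (forall eps : R, 0 < eps -> exists2 t, (N <= t)%N & e t < eps) ->
  (forall t, (N <= t)%N -> d t.+1 <= d t + delta t) ->
  (forall (eps : R) N0, 0 < eps -> exists2 t, (N0 <= t)%N & d t < eps) ->
  (forall t, (N <= t)%N -> 0 < e t -> d t < rho -> delta t < rho -> e t < rho ->
    1 <= K * (1 - theta) * e t `^ (- theta) * delta t) ->
  [/\ theta = 0 -> exists N0, forall t, (N0 <= t)%N -> delta t = 0,
      0 < theta <= 1 / 2 -> exists eta kappa : R, [/\ 0 < eta < 1, 0 < kappa &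
        exists N0, forall t, (N0 <= t)%N -> delta t <= kappa * eta ^+ t] &
      1 / 2 < theta -> exists2 kappa : R, 0 < kappa &
        exists N0, forall t, (N0 <= t)%N ->
          delta t <= kappa * t%:R `^ (- (1 / (4 * theta - 2)))].
Proof.
move=> a0 K0 th0 th1 rho0 delta0 e0 e_decr e_small d_step d_small kl.
have [[s Ns es]|e_gt0'] := pselect (exists2 s, (N <= s)%N & e s <= 0).
  have stop t : (s <= t)%N -> delta t = 0.
    move=> st; have Nt := leq_trans Ns st; apply/eqP; rewrite -sqrf_eq0 eq_le.
    rewrite sqr_ge0 andbT -(pmulr_rle0 _ a0).
    apply: le_trans (sqr_step_le _ _ _ _ e0 e_decr _ Nt) _.
    exact: le_trans (value_nonincreasing _ _ _ _ a0 e_decr _ _ Ns st) es.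
  split=> _; first by exists s.
  - exists (1 / 2), 1; split; [lra|lra|exists s => t /stop ->].
    by rewrite mul1r exprn_ge0.
  - by exists 1 => //; exists s => t /stop ->; rewrite mul1r powR_ge0.
have e_gt0 t : (N <= t)%N -> 0 < e t.
  by move=> Nt; rewrite ltNge; apply/negP => et; apply: e_gt0'; exists t.
have [N0 [NN0 klN0]] : exists N0, (N <= N0)%N /\ forall t, (N0 <= t)%N ->
    1 <= K * (1 - theta) * e t `^ (- theta) * delta t.
  apply: (kl_trap a K theta d e delta N _ _ _ _ _ _ _ _ _ rho) => //.
  by move=> t Nt; apply: kl => //; exact: e_gt0.
pose M := K * (1 - theta); have M0 : 0 < M by rewrite mulr_gt0// subr_gt0.
pose b := a / M ^+ 2; have b0 : 0 < b by rewrite divr_gt0// exprn_gt0.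
have recursion t : (N0 <= t)%N -> e t.+1 <= e t - b * e t `^ (2 * theta).
  move=> N0t; have Nt := leq_trans NN0 N0t.
  apply: le_trans (e_decr _ Nt) _; rewrite lerD2l lerN2.
  have E0 : 0 < e t `^ theta by rewrite powR_gt0// e_gt0.
  have h : e t `^ (2 * theta) <= M ^+ 2 * delta t ^+ 2.
    rewrite mulrC powRrM (powR_mulrn 2%N (ltW E0)) -exprMn.
    have Md0 : 0 <= M * delta t by apply: mulr_ge0 => //; exact: ltW.
    rewrite ler_pXn2r ?nnegrE ?(ltW E0)//.
    by have := klN0 _ N0t; rewrite -/M powRN mulrAC ler_pdivlMr// mul1r.
  have M20 : 0 < M ^+ 2 by rewrite exprn_gt0.
  by rewrite /b mulrAC ler_pdivrMr// -mulrA ler_pM2l// [leRHS]mulrC.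
have stepN0 t (C X : R) : (N0 <= t)%N -> 0 <= C -> 0 <= X ->
    e t <= C * X ^+ 2 -> delta t <= Num.sqrt (C / a) * X.
  move=> N0t; apply: (step_le_sqrt a e delta N) => //; exact: leq_trans N0t.
split=> [th|/andP[thp thh]|thh].
- have [s Ns es] := e_small _ b0.
  have [t0 t0N0] : exists t, (maxn s N0 <= t)%N by exists (maxn s N0).
  move: t0N0; rewrite geq_max => /andP[st N0t].
  have := recursion _ N0t; rewrite th mulr0 powRr0 mulr1.
  have := e_gt0 _ (leq_trans NN0 (leq_trans N0t (leqnSn t0))).
  have := value_nonincreasing _ _ _ _ a0 e_decr _ _ Ns st.
  by move=> h1 h2 h3; exfalso; lra.
(* Below [1], a power of exponent [2 * theta <= 1] dominates the identity. *)
- have [N1 [NN1 eN1]] := value_eventually_small _ _ _ _ a0 e_decr e_small _ ltr01.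
  have [|eta [C [etai C0 eC]]] := @geometric_decay R e b (maxn N0 N1) b0.
    move=> t; rewrite geq_max => /andP[N0t N1t].
    have et := e_gt0 _ (leq_trans NN0 N0t); split=> //.
    apply: le_trans (recursion _ N0t) _; rewrite mulrBl mul1r lerD2l lerN2.
    rewrite ler_wpM2l ?(ltW b0)//; apply: ger1_powR; last by lra.
    by rewrite et ltW// eN1.
  exists eta, (Num.sqrt (C / a)); split=> //; first by rewrite sqrtr_gt0 divr_gt0.
  exists (maxn N0 N1) => t tN; have := eC t tN.
  move: tN; rewrite geq_max => /andP[N0t N1t]; apply: stepN0 => //; first exact: ltW.
  by case/andP: etai => etai _; rewrite exprn_ge0// ltW.
- have p0 : 0 < 2 * theta - 1 by lra.
  have [|C C0 eC] := @power_decay R e b (2 * theta - 1) N0 b0 p0.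
    move=> t N0t; split; first by apply: e_gt0; exact: leq_trans N0t.
    by rewrite subrKC recursion.
  exists (Num.sqrt (C / a)); first by rewrite sqrtr_gt0 divr_gt0.
  exists N0.*2.+1 => t tN; apply: stepN0; rewrite ?powR_ge0 ?(ltW C0)//.
    by rewrite (leq_trans _ tN)// -addnn -addnS leq_addr.
  rewrite -powR_mulrn ?powR_ge0// -powRrM (_ : _ * 2%:R = - (2 * theta - 1)^-1).
    exact: eC.
  by field; apply/andP; split; lra.
Qed.

(** * Proximal subgradients and the merit function *)

Section proximal_subgradients.
Context {R : realType} {n : nat}.
Implicit Types (h : 'rV[R]_n -> \bar R) (x v : 'rV[R]_n).

(** A global lower bound by a concave quadratic touching [h] at [x] makes the
    difference quotient at least [- C * enorm (z - x)], which tends to [0].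
    All subgradients below arise in this way, as optimality conditions of
    proximal problems. *)
Lemma proximal_regular_subdiff h x v (r C : R) : h x = r%:E ->
  (forall z, ((r + dot v (z - x) - C * dot (z - x) (z - x))%:E <= h z)%E) ->
  regular_subdiff h x v.
Proof.
move=> hx hle; split; first by rewrite hx ltry.
rewrite limf_einfE; apply/lee_addgt0Pr => e e0.
rewrite -leeBlDr// sub0e.
(* A radius at which [C * enorm (z - x)] stays below [e]. *)
pose k := e / (`|C| + 1).
have k0 : 0 < k by rewrite divr_gt0// ltr_wpDl.
pose V := [set z | z != x /\ enorm (z - x) < k].
apply: le_ereal_sup_tmp; eexists.
  exists V; last reflexivity.
  have := near_enorm_lt x _ k0.
  rewrite /dnbhs /within /=; apply: filterS => z zk zx; split => //.
apply: le_ereal_inf_tmp => _ [z [zx zk] <-].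
have p0 : 0 < enorm (z - x) by rewrite enorm_gt0 subr_eq0.
rewrite hx; have := hle z; case: (h z) => [s| |] //=.
- rewrite -!EFinB -EFinM !lee_fin -sqr_enorm => sle.
  rewrite ler_pdivlMr//; move: zk; rewrite /k ltr_pdivlMr ?ltr_wpDl// => zk.
  have : C * enorm (z - x) ^+ 2 <= enorm (z - x) * (enorm (z - x) * (`|C| + 1)).
    rewrite mulrC mulrA -expr2 ler_wpM2l ?sqr_ge0//.
    by rewrite (le_trans (ler_norm C))// lerDl.
  have : enorm (z - x) * (enorm (z - x) * (`|C| + 1)) <= enorm (z - x) * e.
    by rewrite ler_pM2l// ltW.
  lra.
- by move=> _; rewrite gt0_mulye ?leey// lte_fin invr_gt0.
Qed.

Lemma regular_limiting_subdiff h x v :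
  regular_subdiff h x v -> limiting_subdiff h x v.
Proof.
move=> hxv; split; first by case: hxv.
by exists (fun=> x), (fun=> v); split => //; exact: cvg_cst.
Qed.

Lemma dist0_le (S : set 'rV[R]_n) v (b : R) : S v -> enorm v <= b ->
  (dist0 S <= b%:E)%E.
Proof.
move=> Sv vb; apply: (@le_trans _ _ (enorm v)%:E); last by rewrite lee_fin.
by apply: ereal_inf_lbound; exists v.
Qed.

End proximal_subgradients.

Section merit.
Context {R : realType} {n : nat} (f : 'rV[R]_n -> R) (g : 'rV[R]_n -> \bar R).
Context (gamma : R).
Implicit Types (x y z u v : 'rV[R]_n).

(** The polarization identity brings the quadratic part of the merit function
    into this form, in which the [y]-step is visibly a descent step. *)
Definition smooth_merit y z x : R :=
  f y + (2 * gamma)^-1 * (dot (x - y) (x - y) - dot (x - z) (x - z)).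

Lemma dr_meritE y z x :
  dr_merit f g gamma y z x = (g z + (smooth_merit y z x)%:E)%E.
Proof.
rewrite /dr_merit (addeC _ (g z)) -!addeA; congr (_ + _)%E.
rewrite -!EFinN -!EFinD; congr (_%:E).
rewrite /smooth_merit sqr_enorm invfM !dotE.
by rewrite (dotC z y) (dotC y x) (dotC z x); lra.
Qed.

(** The sum rule, by hand: lower quadratic bounds for [f] at [y] and for [g] at
    [z] add up to one for the merit function, the coupling term being a
    quadratic form whose remainder is at least
    [- gamma^-1 * (|x' - x|^2 + |z' - z|^2)]. *)
Lemma merit_subgradient (l C : R) y z x v (r : R) : 0 < gamma ->
  (forall u, f y + dot (grad f y) (u - y) - l / 2 * dot (u - y) (u - y) <= f u) ->
  g z = r%:E ->
  (forall u, ((r + dot v (u - z) - C * dot (u - z) (u - z))%:E <= g u)%E) ->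
  limiting_subdiff (dr_merit3 f g gamma) (pack3 y z x)
    (pack3 (grad f y - gamma^-1 *: (x - y)) (v + gamma^-1 *: (x - z))
           (gamma^-1 *: (z - y))).
Proof.
move=> gamma0 fy gz gle; apply: regular_limiting_subdiff.
apply: (proximal_regular_subdiff _ _ _ (r + smooth_merit y z x)
  (`|l| / 2 + `|C| + gamma^-1)).
  by rewrite dr_merit3E dr_meritE gz.
move=> w; rewrite (pack3_surj _ w).
move: (lsubmx (lsubmx w)) (rsubmx (lsubmx w)) (rsubmx w) => y' z' x'.
rewrite dr_merit3E dr_meritE pack3B !dot_pack3.
have := gle z'; case: (g z') => [s|_|//]; last by rewrite addye// leey.
rewrite !lee_fin /smooth_merit => gs; have := fy y'.
have gi0 : 0 < gamma^-1 by rewrite invr_gt0.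
have -> : x' - y' = (x - y) + ((x' - x) - (y' - y)).
  by apply/rowP => i; rewrite !mxE; ring.
have -> : x' - z' = (x - z) + ((x' - x) - (z' - z)).
  by apply/rowP => i; rewrite !mxE; ring.
have -> : z - y = (x - y) - (x - z) by apply/rowP => i; rewrite !mxE; ring.
move: gs; move: (y' - y) (z' - z) (x' - x) (x - y) (x - z) => dy dz dx p q.
have := dot_ge0 (dx - dy); have := dot_ge0 (dx + dz).
have := dot_ge0 dy; have := dot_ge0 dz; have := dot_ge0 dx.
rewrite invfM !dotE (dotC dy p) (dotC dx p) (dotC dx q) (dotC dz q)
  (dotC dy dx) (dotC dz dx).
have := normr_ge0 l; have := normr_ge0 C; have := ler_norm l; have := ler_norm C.
move: (`|l|) (`|C|) (gamma^-1) gi0 => L' C' k k0 hC hl C'0 L'0.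
move: (dot (grad f y) dy) (dot v dz) (dot dx dx) (dot dy dy) (dot dz dz).
move: (dot p p) (dot q q) (dot p dx) (dot p dy) (dot q dx) (dot q dz).
move: (dot dx dy) (dot dx dz) => xy xz pp qq px py qx qz fy' vz xx yy zz.
move=> xx0 zz0 yy0 xz0 xy0 gs fs.
have nonneg (a b : R) : 0 <= a -> 0 <= b -> 0 <= a * b by exact: mulr_ge0.
have := nonneg _ _ (ltW k0) xz0; have := nonneg _ _ (ltW k0) xy0.
have := nonneg _ _ (ltW k0) yy0.
have := nonneg _ _ L'0 xx0; have := nonneg _ _ L'0 zz0.
have := nonneg _ _ C'0 xx0; have := nonneg _ _ C'0 yy0.
have := ler_wpM2r yy0 hl; have := ler_wpM2r zz0 hC.
lra.
Qed.

End merit.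

(** * Douglas-Rachford iterates *)

Lemma argmin_prox {R : realType} {n : nat} (g : 'rV[R]_n -> \bar R)
    (k : R) (w z : 'rV[R]_n) : proper_fun g ->
  argmin (fun u => g u + (k * enorm (w - u) ^+ 2)%:E)%E z ->
  g z = (fine (g z))%:E /\
  forall u, ((fine (g z) + k * (dot (w - z) (w - z) - dot (w - u) (w - u)))%:E
             <= g u)%E.
Proof.
move=> [gNy [u0 gu0]] zmin; have := gNy z; have := zmin u0.
case gz : (g z) => [r| |] //=; last first.
  by rewrite addye//; case: (g u0) gu0.
move=> _ _; split=> // u; have := zmin u; have := gNy u; rewrite gz !sqr_enorm.
case: (g u) => [s _|_ _|//]; last exact: leey.
by rewrite -!EFinD !lee_fin; lra.
Qed.

Section iterates.
Context {R : realType} {n : nat} (f : 'rV[R]_n -> R) (g : 'rV[R]_n -> \bar R).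
Context (L l gamma : R) (y z x : nat -> 'rV[R]_n).
Hypothesis L_gt0 : 0 < L.
Hypothesis gamma_gt0 : 0 < gamma.
Hypothesis f_diff : forall u, differentiable f u.
Hypothesis f_lip : lipschitz_grad f L.
Hypothesis f_cvx : convex_function [set: convex_lmodType 'rV[R]_n]
  (fun u : 'rV[R]_n => f u + l / 2 * enorm u ^+ 2).
Hypothesis g_proper : proper_fun g.
Hypothesis dr : dr_sequence f g gamma (x 0%N) y z x.

Let delta t := enorm (y t.+1 - y t).
Let merit t := fine (g (z t)) + smooth_merit f gamma (y t) (z t) (x t).

Lemma dr_x t : x t.+1 - x t = z t.+1 - y t.+1.
Proof. by have [_ /(_ t)[_ _ ->]] := dr; rewrite addrAC subrr add0r. Qed.

Lemma dr_grad t : grad f (y t.+1) = gamma^-1 *: (x t - y t.+1).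
Proof. by have [_ /(_ t)[ymin _ _]] := dr; exact: prox_grad ymin. Qed.

Lemma dr_g_fin t : g (z t.+1) = (fine (g (z t.+1)))%:E.
Proof. by have [_ /(_ t)[_ /(argmin_prox _ _ _ _ g_proper)[]]] := dr. Qed.

Lemma dr_g_min t u :
  ((fine (g (z t.+1)) + (2 * gamma)^-1 *
     (dot (2 *: y t.+1 - x t - z t.+1) (2 *: y t.+1 - x t - z t.+1) -
      dot (2 *: y t.+1 - x t - u) (2 *: y t.+1 - x t - u)))%:E <= g u)%E.
Proof. by have [_ /(_ t)[_ /(argmin_prox _ _ _ _ g_proper)[_]]] := dr. Qed.

(** The [z]-step in the form required by [proximal_regular_subdiff]. *)
Lemma dr_g_prox t u :
  ((fine (g (z t.+1)) + dot (gamma^-1 *: (2 *: y t.+1 - x t - z t.+1))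
     (u - z t.+1) - (2 * gamma)^-1 * dot (u - z t.+1) (u - z t.+1))%:E
   <= g u)%E.
Proof.
apply: le_trans (dr_g_min t u); rewrite lee_fin.
move: (2 *: y t.+1 - x t) => w.
have -> : w - u = (w - z t.+1) - (u - z t.+1).
  by apply/rowP => i; rewrite !mxE; ring.
move: (w - _) (u - _) => p q; rewrite invfM !dotE (dotC q p); lra.
Qed.

Lemma dr_meritE3 t :
  dr_merit3 f g gamma (pack3 (y t.+1) (z t.+1) (x t.+1)) = (merit t.+1)%:E.
Proof. by rewrite dr_merit3E dr_meritE dr_g_fin. Qed.

(** By its optimality condition, the [y]-step recovers [x t] from [y t.+1]
    through the Lipschitz map [y + gamma * grad f y].  The displacement of [x]
    is bounded by the step that [y] makes next. *)
Lemma dx_le t : enorm (x t.+1 - x t) <= (1 + gamma * L) * delta t.+1.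
Proof.
have xE s : x s = y s.+1 + gamma *: grad f (y s.+1).
  by rewrite dr_grad scalerA mulfV ?gt_eqF// scale1r subrKC.
rewrite (xE t.+1) (xE t) opprD addrACA -scalerBr mulrDl mul1r.
rewrite (le_trans (enorm_triangle _ _))// lerD2l enormZ gtr0_norm// -mulrA.
by rewrite ler_wpM2l ?(ltW gamma_gt0)// f_lip.
Qed.

(** The three updates act separately.  The [x]-update raises the merit function
    by [gamma^-1 * |x t.+2 - x t.+1|^2], which the minimality of [z t.+2]
    compensates up to [gamma^-1 * |y t.+2 - z t.+1|^2]; the [y]-step gains
    [(gamma^-1 - l) / 2 * delta t.+1 ^+ 2].  Monotonicity of [grad f + l] and
    [dx_le] bound the remaining square by
    [(2 * gamma * l - 1 + (1 + gamma * L) ^+ 2) * delta t.+1 ^+ 2]. *)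
Lemma merit_decrease t : merit t.+2 <=
  merit t.+1 - gamma^-1 * (3 / 2 - 5 * gamma * l / 2 - (1 + gamma * L) ^+ 2)
               * delta t.+1 ^+ 2.
Proof.
have := dr_g_min t.+1 (z t.+1); rewrite (dr_g_fin t) lee_fin => gz.
have := weakly_convex_grad f l f_diff f_cvx (y t.+2) (y t.+1).
have := grad_monotone f l f_diff f_cvx (y t.+1) (y t.+2).
have xi_le : dot (x t.+1 - x t) (x t.+1 - x t) <=
    (1 + gamma * L) ^+ 2 * delta t.+1 ^+ 2.
  rewrite -sqr_enorm -exprMn ler_pXn2r ?dx_le// nnegrE ?enorm_ge0//.
  by rewrite mulr_ge0 ?enorm_ge0// addr_ge0// mulr_ge0 ?ltW.
rewrite !dr_grad /merit /smooth_merit; move: gz.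
have dx0 := dr_x t; have dx1 := dr_x t.+1.
(* All the vectors that occur are combinations of [p], the step [D] of [y] and
   two consecutive steps [xi] and [ze] of [x]; the claim then is linear in
   their inner products. *)
pose p := x t.+1 - y t.+2; pose D := y t.+2 - y t.+1.
pose xi := x t.+1 - x t; pose ze := x t.+2 - x t.+1.
have zE0 : z t.+1 = y t.+1 + xi by rewrite /xi dx0 subrKC.
have zE1 : z t.+2 = y t.+2 + ze by rewrite /ze dx1 subrKC.
have -> : 2 *: y t.+2 - x t.+1 - z t.+2 = - p - ze.
  by rewrite zE1 /p; apply/rowP => i; rewrite !mxE; ring.
have -> : 2 *: y t.+2 - x t.+1 - z t.+1 = - p - xi + D.
  by rewrite zE0 /p /D; apply/rowP => i; rewrite !mxE; ring.
have -> : x t.+2 - y t.+2 = p + ze.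
  by rewrite /p /ze; apply/rowP => i; rewrite !mxE; ring.
have -> : x t.+2 - z t.+2 = p.
  by rewrite zE1 /p /ze; apply/rowP => i; rewrite !mxE; ring.
have -> : x t.+1 - y t.+1 = p + D.
  by rewrite /p /D; apply/rowP => i; rewrite !mxE; ring.
have -> : x t.+1 - z t.+1 = p - xi + D.
  by rewrite zE0 /p /D; apply/rowP => i; rewrite !mxE; ring.
have -> : x t - y t.+1 = p - xi + D.
  by rewrite /xi /p /D; apply/rowP => i; rewrite !mxE; ring.
rewrite -(opprB (y t.+2) (y t.+1)) -/p -/D; move: xi_le; rewrite -/xi.
rewrite /delta sqr_enorm -/D.
move: p D xi ze {zE0 zE1} => p D xi ze.
rewrite invfM !dotE (dotC ze p) (dotC xi p) (dotC D p) (dotC D xi).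
have -> : gamma^-1 * (3 / 2 - 5 * gamma * l / 2 - (1 + gamma * L) ^+ 2) =
    gamma^-1 * (3 / 2) - 5 * l / 2 - gamma^-1 * (1 + gamma * L) ^+ 2.
  by field; rewrite gt_eqF.
have k0 : 0 <= gamma^-1 by rewrite invr_ge0 ltW.
move: gamma^-1 k0 ((1 + gamma * L) ^+ 2) => k k0 q2.
move=> /(ler_wpM2l k0); lra.
Qed.

(** At an iterate the optimality conditions of both proximal steps cancel every
    term of the subgradient except the last displacement of [x], which appears
    in the three blocks; hence a norm of [sqrt 3 <= 2] times it, over
    [gamma]. *)
Lemma merit_subgradient_le t :
  (dist0 (limiting_subdiff (dr_merit3 f g gamma)
     (pack3 (y t.+1) (z t.+1) (x t.+1))) <=
   (2 * gamma^-1 * (1 + gamma * L) * delta t.+1)%:E)%E.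
Proof.
apply: dist0_le.
  apply: merit_subgradient gamma_gt0 _ (dr_g_fin t) (dr_g_prox t).
  exact: weakly_convex_grad.
have -> : pack3 (grad f (y t.+1) - gamma^-1 *: (x t.+1 - y t.+1))
    (gamma^-1 *: (2 *: y t.+1 - x t - z t.+1) + gamma^-1 *: (x t.+1 - z t.+1))
    (gamma^-1 *: (z t.+1 - y t.+1)) =
    pack3 (- (gamma^-1 *: (x t.+1 - x t))) (- (gamma^-1 *: (x t.+1 - x t)))
      (gamma^-1 *: (x t.+1 - x t)).
  have zE : z t.+1 = y t.+1 + (x t.+1 - x t) by rewrite dr_x subrKC.
  rewrite dr_grad zE; congr pack3; apply/rowP => i; rewrite !mxE; ring.
have := dx_le t; have := enorm_ge0 (x t.+1 - x t).
set q := (1 + gamma * L) * _; set dx := x t.+1 - x t => dx0 dxq.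
have q0 := le_trans dx0 dxq; have k0 : 0 <= gamma^-1 by rewrite invr_ge0 ltW.
have kdx0 : 0 <= gamma^-1 * enorm dx by rewrite mulr_ge0.
have kdxq : gamma^-1 * enorm dx <= gamma^-1 * q by rewrite ler_wpM2l.
apply: le_enorm; first by rewrite -mulrA -/q; apply: mulr_ge0 => //; exact: mulr_ge0.
rewrite dot_pack3 dotNl dotNr opprK -sqr_enorm enormZ ger0_norm// -!mulrA -/q.
by nra.
Qed.

(** The subgradient of [g] given by the [z]-step, and the gradient of [f] given
    by the [y]-step at [y t.+1] instead of [z t.+1], sum up to a multiple of
    [z t.+1 - y t.+1], the last displacement of [x]. *)
Lemma stationarity_residual t : exists2 s, stationarity_set f g (z t.+1) s &
  enorm s <= (L + gamma^-1) * (1 + gamma * L) * delta t.+1.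
Proof.
exists (grad f (z t.+1) + gamma^-1 *: (2 *: y t.+1 - x t - z t.+1)).
  exists (gamma^-1 *: (2 *: y t.+1 - x t - z t.+1)) => //.
  apply: regular_limiting_subdiff.
  exact: proximal_regular_subdiff (dr_g_fin t) (dr_g_prox t).
have -> : grad f (z t.+1) + gamma^-1 *: (2 *: y t.+1 - x t - z t.+1) =
    (grad f (z t.+1) - grad f (y t.+1)) - gamma^-1 *: (z t.+1 - y t.+1).
  by rewrite dr_grad; apply/rowP => i; rewrite !mxE; ring.
have k0 : 0 <= gamma^-1 by rewrite invr_ge0 ltW.
rewrite (le_trans (enorm_triangle _ _))// enormN enormZ ger0_norm//.
apply: (@le_trans _ _ ((L + gamma^-1) * enorm (z t.+1 - y t.+1))).
  by rewrite mulrDl lerD2r.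
by rewrite -mulrA ler_wpM2l ?addr_ge0 ?(ltW L_gt0)// -dr_x dx_le.
Qed.

End iterates.

(** * Cluster points of the iterates *)

Section limits.
Context {R : realType} {n : nat}.

Lemma cvg_dot_self {T : Type} {F : set_system T} {FF : Filter F}
    (u : T -> 'rV[R]_n) (a : 'rV[R]_n) :
  u @ F --> a -> dot (u t) (u t) @[t --> F] --> dot a a.
Proof.
move=> ua; have ui i : u t 0 i @[t --> F] --> a 0 i.
  exact: (cvg_comp _ _ ua (@coord_continuous _ _ _ 0 i a)).
apply: cvg_big => [|i _]; [exact: add_continuous|exact: cvgM].
Qed.

Lemma cvg_enorm (u : nat -> 'rV[R]_n) (a : 'rV[R]_n) :
  (forall j, enorm (u j - a) < j.+1%:R^-1) -> u @ \oo --> a.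
Proof.
move=> ua; apply/cvgrPdist_lt => e e0; near=> j.
rewrite distrC; apply: le_lt_trans (normr_le_enorm _) _.
apply: lt_trans (ua j) _; near: j; exact: near_infty_natSinv_lt (PosNum e0).
Unshelve. all: by end_near. Qed.

Lemma cluster_pack3 (y z x : nat -> 'rV[R]_n) (ys zs xs : 'rV[R]_n) :
  cluster ((fun t => pack3 (y t) (z t) (x t)) @ \oo) (pack3 ys zs xs) ->
  forall (e : R) N, 0 < e -> exists2 t, (N <= t)%N &
    [/\ enorm (y t - ys) < e, enorm (z t - zs) < e & enorm (x t - xs) < e].
Proof.
move=> cl e N e0.
have tailN : ((fun t => pack3 (y t) (z t) (x t)) @ \oo)
    [set w | exists2 t, (N <= t)%N & w = pack3 (y t) (z t) (x t)].
  by exists N => // t /= Nt; exists t.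
have [_ [[t Nt ->]]] := cl _ _ tailN (near_enorm_lt (pack3 ys zs xs) _ e0).
rewrite /= pack3B => we; exists t => //.
have part u : dot u u <= enorm (pack3 (y t - ys) (z t - zs) (x t - xs)) ^+ 2 ->
    enorm u < e.
  by move=> /(le_enorm _ _ (enorm_ge0 _))/le_lt_trans; apply.
have := dot_ge0 (y t - ys); have := dot_ge0 (z t - zs); have := dot_ge0 (x t - xs).
by move=> h1 h2 h3; split; apply: part; rewrite enorm_pack3 !sqr_enorm; lra.
Qed.

Lemma enorm_eq0_small (u : 'rV[R]_n) :
  (forall e : R, 0 < e -> enorm u <= e) -> u = 0.
Proof.
move=> h; apply/eqP; rewrite -enorm_eq0 eq_le enorm_ge0 andbT.
by apply/ler_addgt0Pr => e e0; rewrite add0r h.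
Qed.

End limits.

Section cluster_point.
Context {R : realType} {n : nat} (f : 'rV[R]_n -> R) (g : 'rV[R]_n -> \bar R).
Context (L l gamma : R) (y z x : nat -> 'rV[R]_n) (ys zs xs : 'rV[R]_n).
Hypothesis L_gt0 : 0 < L.
Hypothesis gamma_gt0 : 0 < gamma.
Hypothesis f_diff : forall u, differentiable f u.
Hypothesis f_lip : lipschitz_grad f L.
Hypothesis f_cvx : convex_function [set: convex_lmodType 'rV[R]_n]
  (fun u : 'rV[R]_n => f u + l / 2 * enorm u ^+ 2).
Hypothesis g_proper : proper_fun g.
Hypothesis g_closed : lower_semicontinuous g.
Hypothesis dr : dr_sequence f g gamma (x 0%N) y z x.
Hypothesis gamma_small :
  (1 + gamma * L) ^+ 2 + 5 * gamma * l / 2 - 3 / 2 < 0.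
Hypothesis clust : forall (e : R) N, 0 < e -> exists2 t, (N <= t)%N &
  [/\ enorm (y t - ys) < e, enorm (z t - zs) < e & enorm (x t - xs) < e].

Let delta t := enorm (y t.+1 - y t).
Let merit t := fine (g (z t)) + smooth_merit f gamma (y t) (z t) (x t).
Let a := gamma^-1 * (3 / 2 - 5 * gamma * l / 2 - (1 + gamma * L) ^+ 2).

Lemma decrease_rate_gt0 : 0 < a.
Proof. by rewrite /a mulr_gt0 ?invr_gt0//; have := gamma_small; lra. Qed.

Lemma merit_decr t : (1 <= t)%N -> merit t.+1 <= merit t - a * delta t ^+ 2.
Proof. by case: t => // t _; apply: merit_decrease. Qed.

Lemma merit_nonincreasing s t : (1 <= s)%N -> (s <= t)%N -> merit t <= merit s.
Proof. exact: (value_nonincreasing a merit delta 1 decrease_rate_gt0 merit_decr). Qed.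

Lemma cluster_subseq : exists s : nat -> nat, [/\ forall j, (j < s j)%N,
  y (s j) @[j --> \oo] --> ys, z (s j) @[j --> \oo] --> zs &
  x (s j) @[j --> \oo] --> xs].
Proof.
have /choice[s sP] : forall j, exists t, (j < t)%N /\
    [/\ enorm (y t - ys) < j.+1%:R^-1, enorm (z t - zs) < j.+1%:R^-1 &
        enorm (x t - xs) < j.+1%:R^-1].
  move=> j; have j0 : 0 < j.+1%:R^-1 :> R by rewrite invr_gt0.
  by have [t jt tP] := clust _ j.+1 j0; exists t.
by exists s; split=> [j|||]; [|apply: cvg_enorm => j..]; have [? []] := sP j.
Qed.

Lemma cvg_smooth_merit (s : nat -> nat) :
  y (s j) @[j --> \oo] --> ys -> z (s j) @[j --> \oo] --> zs ->
  x (s j) @[j --> \oo] --> xs ->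
  smooth_merit f gamma (y (s j)) (z (s j)) (x (s j)) @[j --> \oo] -->
    smooth_merit f gamma ys zs xs.
Proof.
move=> yc zc xc; apply: cvgD.
  exact: (cvg_comp _ _ yc (differentiable_continuous (f_diff ys))).
by apply: cvgMr; apply: cvgB; apply: cvg_dot_self; exact: cvgB.
Qed.

(** Were some [merit t.+1] below the value at the cluster point, so would be
    all later ones, whereas lower semicontinuity lets the merit values exceed,
    along a subsequence, any number below that value.  The statement also
    shows that the value at the cluster point is finite. *)
Lemma merit_cluster_le t :
  (dr_merit3 f g gamma (pack3 ys zs xs) <= (merit t.+1)%:E)%E.
Proof.
rewrite dr_merit3E dr_meritE leNgt; apply/negP => lt.
have [s [js yc zc xc]] := cluster_subseq.
set phi := smooth_merit f gamma ys zs xs in lt.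
have [e e0 ge] : exists2 e : R, 0 < e & ((merit t.+1 - phi + e)%:E < g zs)%E.
  move: lt; have [gNy _] := g_proper; have := gNy zs.
  case: (g zs) => [r _|_ _|//]; last by exists 1; rewrite ?ltry.
  rewrite -EFinD lte_fin => lt; exists ((r + phi - merit t.+1) / 2); first by lra.
  by rewrite lte_fin; lra.
have [V Vzs gV] := g_closed _ _ ge.
have phic := cvg_smooth_merit _ yc zc xc; rewrite -/phi in phic.
have [j [tj [Vj phij]]] : exists j, (t <= j)%N /\ V (z (s j)) /\
    phi - e < smooth_merit f gamma (y (s j)) (z (s j)) (x (s j)).
  have phie : phi - e < phi by rewrite ltrBlDr ltrDl.
  near \oo => j; exists j; split; first by near: j; exists t.
  split; first by near: j; exact: zc.
  by near: j; exact: (cvgr_gt _ phic).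
have := gV _ Vj; have := js j; case: (s j) phij => // k phij jk.
rewrite (dr_g_fin f g gamma y z x)// lte_fin => gk.
have : merit k.+1 <= merit t.+1.
  by apply: merit_nonincreasing => //; rewrite ltnS (leq_trans tj)// -ltnS.
by rewrite /merit in gk *; lra.
Unshelve. all: by end_near. Qed.

Lemma cluster_g_fin : exists r : R, g zs = r%:E.
Proof.
have [gNy _] := g_proper; have := gNy zs; have := merit_cluster_le 0.
by rewrite dr_merit3E dr_meritE; case: (g zs) => [r| |] //; exists r.
Qed.

Let lim_merit := fine (g zs) + smooth_merit f gamma ys zs xs.

Lemma merit_cluster :
  dr_merit3 f g gamma (pack3 ys zs xs) = lim_merit%:E.
Proof.
by rewrite dr_merit3E dr_meritE /lim_merit; have [r ->] := cluster_g_fin.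
Qed.

Lemma lim_merit_le t : (1 <= t)%N -> lim_merit <= merit t.
Proof.
by case: t => // t _; rewrite -lee_fin -merit_cluster merit_cluster_le.
Qed.

(** Lower semicontinuity only bounds [g (z t)] from below.  The opposite
    bound along a subsequence comes from comparing [z t] with [zs] in the
    proximal problem that [z t] solves. *)
Lemma merit_small (e : R) : 0 < e ->
  exists2 t, (1 <= t)%N & merit t - lim_merit < e.
Proof.
move=> e0; have [s [js yc zc xc]] := cluster_subseq.
(* The center [2 *: y t.+1 - x t] of the [z]-step, written with the iterates of
   a single index so that it converges along the subsequence. *)
pose w t := y t - x t + z t.
have gc : smooth_merit f gamma (y (s j)) (z (s j)) (x (s j)) +
    (2 * gamma)^-1 * (dot (w (s j) - zs) (w (s j) - zs) -
                      dot (w (s j) - z (s j)) (w (s j) - z (s j)))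
    @[j --> \oo] --> smooth_merit f gamma ys zs xs + (2 * gamma)^-1 *
     (dot (ys - xs + zs - zs) (ys - xs + zs - zs) -
      dot (ys - xs + zs - zs) (ys - xs + zs - zs)).
  apply: cvgD; first exact: cvg_smooth_merit.
  apply: cvgMr; have wc : w (s j) @[j --> \oo] --> ys - xs + zs.
    by apply: cvgD => //; exact: cvgB.
  apply: cvgB; apply: cvg_dot_self; apply: cvgB => //; exact: cvg_cst.
rewrite subrr mulr0 addr0 in gc.
set phi := smooth_merit f gamma ys zs xs in gc.
have phie : phi < phi + e by rewrite ltrDl.
have [j] : exists j, smooth_merit f gamma (y (s j)) (z (s j)) (x (s j)) +
    (2 * gamma)^-1 * (dot (w (s j) - zs) (w (s j) - zs) -
                      dot (w (s j) - z (s j)) (w (s j) - z (s j))) < phi + e.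
  by near \oo => j; exists j; near: j; exact: (cvgr_lt _ gc).
have := js j; case: (s j) => // k _ wk; exists k.+1 => //.
have := dr_g_min f g gamma y z x g_proper dr k zs.
have zE : z k.+1 = y k.+1 + (x k.+1 - x k).
  by rewrite (dr_x f g gamma y z x dr) subrKC.
have -> : 2 *: y k.+1 - x k = w k.+1.
  by rewrite /w zE; apply/rowP => i; rewrite !mxE; ring.
have [r gr] := cluster_g_fin; rewrite gr lee_fin => gk.
by rewrite /merit /lim_merit gr /=; move: wk gk; rewrite -/phi; lra.
Unshelve. all: by end_near. Qed.

Lemma step_small (e : R) : 0 < e ->
  exists N, (1 <= N)%N /\ forall t, (N <= t)%N -> delta t < e.
Proof.
apply: (step_eventually_small a (fun t => merit t - lim_merit) delta 1
  decrease_rate_gt0).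
- by move=> t; exact: enorm_ge0.
- by move=> t t1; rewrite subr_ge0 lim_merit_le.
- by move=> t t1; have := merit_decr _ t1; lra.
- exact: merit_small.
Qed.

Let M := 1 + gamma * L.

Let M_gt0 : 0 < M.
Proof. by rewrite /M ltr_pwDl// mulr_ge0// ltW. Qed.

(** The gap [z t - y t] is a displacement of [x], so it vanishes in the
    limit. *)
Lemma cluster_z : zs = ys.
Proof.
apply/eqP; rewrite -subr_eq0; apply/eqP/enorm_eq0_small => e e0.
have M2 : 0 < 2 + M by rewrite addr_gt0.
have e'0 : 0 < e / (2 + M) by rewrite divr_gt0.
have [N [N1 dN]] := step_small _ e'0.
have [t Nt [yt zt _]] := clust _ N e'0.
have t1 := leq_trans N1 Nt; have := dN _ Nt.
case: t t1 {Nt dN} yt zt => // t _ yt zt dt.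
have -> : zs - ys = (y t.+1 - ys) - (z t.+1 - zs) + (z t.+1 - y t.+1).
  by apply/rowP => i; rewrite !mxE; ring.
have := enorm_triangle (y t.+1 - ys - (z t.+1 - zs)) (z t.+1 - y t.+1).
have := enorm_triangle (y t.+1 - ys) (- (z t.+1 - zs)).
rewrite enormN -(dr_x f g gamma y z x dr).
have := dx_le f g L gamma y z x gamma_gt0 f_diff f_lip dr t.
rewrite -/M -/(delta _); set p := e / (2 + M) in e'0 yt zt dt.
have Md : M * delta t.+1 <= M * p by rewrite ler_wpM2l ?ltW.
have : p * (2 + M) = e by rewrite /p divfK// gt_eqF.
lra.
Qed.

Lemma cluster_x : xs = ys + gamma *: grad f ys.
Proof.
apply/eqP; rewrite -subr_eq0; apply/eqP/enorm_eq0_small => e e0.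
have M2 : 0 < 1 + 2 * M by rewrite ltr_wpDl// mulr_gt0.
have e'0 : 0 < e / (1 + 2 * M) by rewrite divr_gt0.
have [N [N1 dN]] := step_small _ e'0.
have [t Nt [yt _ xt]] := clust _ N e'0.
have t1 := leq_trans N1 Nt; have := dN _ Nt.
case: t t1 {Nt dN} yt xt => // t _ yt xt dt.
have -> : xs - (ys + gamma *: grad f ys) =
    (y t.+1 - ys) - (x t.+1 - xs) + gamma *: (grad f (y t.+1) - grad f ys)
    + (x t.+1 - x t).
  rewrite scalerBr (dr_grad f g gamma y z x f_diff dr) scalerA mulfV ?gt_eqF//.
  by rewrite scale1r; apply/rowP => i; rewrite !mxE; ring.
have := enorm_triangle (y t.+1 - ys - (x t.+1 - xs) +
  gamma *: (grad f (y t.+1) - grad f ys)) (x t.+1 - x t).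
have := enorm_triangle (y t.+1 - ys - (x t.+1 - xs))
  (gamma *: (grad f (y t.+1) - grad f ys)).
have := enorm_triangle (y t.+1 - ys) (- (x t.+1 - xs)).
rewrite enormN enormZ gtr0_norm//.
have := dx_le f g L gamma y z x gamma_gt0 f_diff f_lip dr t.
have := f_lip (y t.+1) ys.
rewrite -/M -/(delta _); set p := e / (1 + 2 * M) in e'0 yt xt dt.
move=> /(ler_wpM2l (ltW gamma_gt0)).
have Md : M * delta t.+1 <= M * p by rewrite ler_wpM2l ?ltW.
have : gamma * (L * enorm (y t.+1 - ys)) <= gamma * L * p.
  by rewrite mulrA ler_wpM2l ?mulr_ge0 ?(ltW gamma_gt0) ?(ltW L_gt0)// ltW.
have : p * (1 + 2 * M) = e by rewrite /p divfK// gt_eqF.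
rewrite /M in Md *; lra.
Qed.

(** [(y t, z t, x t)] is a Lipschitz function of [y t] and [y t.+1] that takes
    the value [(ys, zs, xs)] when both are [ys].  Hence the distance to the
    cluster point can be monitored on [y] alone. *)
Lemma near_cluster (eta : R) : 0 < eta -> exists2 rho : R, 0 < rho &
  forall t, (1 <= t)%N -> enorm (y t - ys) < rho -> delta t < rho ->
    enorm (pack3 (y t) (z t) (x t) - pack3 ys zs xs) < eta.
Proof.
move=> eta0; have M3 : 0 < 2 + 3 * M by rewrite addr_gt0// mulr_gt0.
(* With [rho] this radius, the blocks [y], [z] and [x] contribute at most
   [rho], [(1 + M) * rho] and [2 * M * rho]. *)
exists (eta / (2 + 3 * M)); first by rewrite divr_gt0.
set p := eta / _; have pE : p * (2 + 3 * M) = eta by rewrite /p divfK// gt_eqF.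
case=> // t _ yt dt; rewrite pack3B.
apply: le_lt_trans (enorm_pack3_le _ _ _ _) _.
have zle : enorm (z t.+1 - zs) <= enorm (y t.+1 - ys) + M * delta t.+1.
  have -> : z t.+1 - zs = (y t.+1 - ys) + (x t.+1 - x t).
    rewrite cluster_z (dr_x f g gamma y z x dr).
    by apply/rowP => i; rewrite !mxE; ring.
  rewrite (le_trans (enorm_triangle _ _))// lerD2l.
  exact: dx_le f g L gamma y z x gamma_gt0 f_diff f_lip dr t.
have xle : enorm (x t.+1 - xs) <= M * (enorm (y t.+1 - ys) + delta t.+1).
  have -> : x t.+1 - xs = (y t.+2 - ys) + gamma *: (grad f (y t.+2) - grad f ys).
    rewrite cluster_x scalerBr (dr_grad f g gamma y z x f_diff dr) scalerA.
    by rewrite mulfV ?gt_eqF// scale1r; apply/rowP => i; rewrite !mxE; ring.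
  have y2 : enorm (y t.+2 - ys) <= enorm (y t.+1 - ys) + delta t.+1.
    have -> : y t.+2 - ys = (y t.+1 - ys) + (y t.+2 - y t.+1).
      by apply/rowP => i; rewrite !mxE; ring.
    exact: enorm_triangle.
  apply: (@le_trans _ _ (M * enorm (y t.+2 - ys))); last first.
    by rewrite ler_wpM2l ?(ltW M_gt0).
  rewrite (le_trans (enorm_triangle _ _))// /M mulrDl mul1r lerD2l.
  by rewrite enormZ gtr0_norm// -mulrA ler_wpM2l ?(ltW gamma_gt0)// f_lip.
have : M * (enorm (y t.+1 - ys) + delta t.+1) <= M * (p + p).
  by rewrite ler_wpM2l ?(ltW M_gt0)// lerD// ltW.
have : M * delta t.+1 <= M * p by rewrite ler_wpM2l ?(ltW M_gt0)// ltW.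
by have := M_gt0; nra.
Qed.

(** The Kurdyka-Lojasiewicz inequality at the iterates, with the distance to
    the subdifferential replaced by its bound in terms of the step. *)
Lemma kl_along_iterates (c theta : R) : 0 < c -> theta < 1 ->
  kl_inequality (dr_merit3 f g gamma) (pack3 ys zs xs) c theta ->
  exists2 rho : R, 0 < rho & forall t, (1 <= t)%N -> 0 < merit t - lim_merit ->
    enorm (y t - ys) < rho -> delta t < rho -> merit t - lim_merit < rho ->
    1 <= c * (2 * gamma^-1 * M) * (1 - theta) *
         (merit t - lim_merit) `^ (- theta) * delta t.
Proof.
move=> c0 th1 [nu [V [nu0 /nbhs_enorm[eta eta0 etaV] kl]]].
have [r r0 near] := near_cluster _ eta0.
have [r' r'0 r'nu] : exists2 r' : R, 0 < r' & (r'%:E <= nu)%E.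
  case: nu nu0 {kl} => [s|_|//]; first by rewrite lte_fin; exists s.
  by exists 1; rewrite ?leey.
exists (Num.min r r'); first by rewrite lt_min r0.
move=> t t1 e0; rewrite !lt_min => /andP[yr _] /andP[dr' _] /andP[_ er'].
have Vt := etaV _ (near _ t1 yr dr').
case: t t1 e0 er' Vt {yr dr'} => // t _ e0 er' Vt.
have := kl _ Vt; rewrite (dr_meritE3 f g gamma y z x g_proper dr) merit_cluster.
rewrite -/(merit t.+1) lte_fin -subr_gt0 => /(_ e0) klt.
have /klt : ((merit t.+1)%:E < lim_merit%:E + nu)%E.
  apply: (@lt_le_trans _ _ (lim_merit + r')%:E); first by rewrite lte_fin; lra.
  by rewrite EFinD leeD2l.
rewrite -EFinB /= => /le_trans klt1.
have w0 : 0 <= c * (1 - theta) * (merit t.+1 - lim_merit) `^ (- theta).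
  by rewrite mulr_ge0 ?powR_ge0// mulr_ge0 ?subr_ge0 ?ltW.
have sub := merit_subgradient_le f g L l gamma y z x gamma_gt0 f_diff f_lip
  f_cvx g_proper dr t.
have := klt1 _ (lee_wpmul2l _ sub); rewrite lee_fin => /(_ w0).
rewrite -EFinM lee_fin -/M -/(delta _) => h; apply: le_trans h _.
by rewrite le_eqVlt; apply/orP; left; apply/eqP; ring.
Qed.

End cluster_point.

(** * Convergence rates *)

Theorem theorem3 (R : realType) (n : nat)
  (f : 'rV[R]_n -> R) (g : 'rV[R]_n -> \bar R) (L l gamma : R)
  (L_gt0 : 0 < L) (gamma_gt0 : 0 < gamma)
  (f_C1 : continuously_differentiable f)
  (f_lip : lipschitz_grad f L)
  (f_cvx : convex_function [set: convex_lmodType 'rV[R]_n]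
             (fun u : 'rV[R]_n => f u + l / 2 * enorm u ^+ 2))
  (g_proper : proper_fun g)
  (g_closed : lower_semicontinuous g)
  (g_prox : forall w : 'rV[R]_n,
     argmin (fun u => gamma%:E * g u + (2^-1 * enorm (u - w) ^+ 2)%:E)%E !=set0)
  (x0 : 'rV[R]_n) (y z x : nat -> 'rV[R]_n)
  (dr : dr_sequence f g gamma x0 y z x)
  (gamma_small :
     (1 + gamma * L) ^+ 2 + 5 * gamma * l / 2 - 3 / 2 < 0)
  (ys zs xs : 'rV[R]_n)
  (clust : cluster ((fun t => pack3 (y t) (z t) (x t)) @ \oo) (pack3 ys zs xs))
  (f_sa : semialgebraic_fun (fun u => (f u)%:E))
  (g_sa : semialgebraic_fun g)
  (theta c : R) (theta_ge0 : 0 <= theta) (theta_lt1 : theta < 1) (c_gt0 : 0 < c)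
  (kl : kl_inequality (dr_merit3 f g gamma) (pack3 ys zs xs) c theta) :
  [/\ theta = 0 ->
        exists t0 : nat, (1 <= t0)%N /\
          forall t : nat, (t0 <= t)%N -> stationarity_set f g (z t) 0,
      0 < theta <= 1 / 2 ->
        exists eta kappa : R, [/\ 0 < eta, eta < 1, 0 < kappa &
          \forall t \near \oo,
            (dist0 (stationarity_set f g (z t)) <= (kappa * eta ^+ t)%:E)%E] &
      1 / 2 < theta ->
        exists kappa : R, 0 < kappa /\
          \forall t \near \oo,
            (dist0 (stationarity_set f g (z t))
             <= (kappa * t%:R `^ (- (1 / (4 * theta - 2))))%:E)%E].
Proof.
have f_diff : forall u, differentiable f u by case: f_C1.
have dr0 : dr_sequence f g gamma (x 0%N) y z x by case: dr.
have clust' := cluster_pack3 y z x ys zs xs clust.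
have M0 : 0 < 1 + gamma * L by rewrite ltr_wpDl// mulr_gt0.
pose merit t := fine (g (z t)) + smooth_merit f gamma (y t) (z t) (x t).
pose lim_merit := fine (g zs) + smooth_merit f gamma ys zs xs.
pose a := gamma^-1 * (3 / 2 - 5 * gamma * l / 2 - (1 + gamma * L) ^+ 2).
pose B := (L + gamma^-1) * (1 + gamma * L).
have B0 : 0 < B by rewrite mulr_gt0// addr_gt0// invr_gt0.
have [rho rho0 klt] := kl_along_iterates f g L l gamma y z x ys zs xs L_gt0
  gamma_gt0 f_diff f_lip f_cvx g_proper g_closed dr0 gamma_small clust'
  c theta c_gt0 theta_lt1 kl.
have dist_le t (b : R) : (1 <= t)%N -> enorm (y t.+1 - y t) <= b ->
    (dist0 (stationarity_set f g (z t)) <= (B * b)%:E)%E.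
  case: t => // t _ bt; have [s sS sB] := stationarity_residual f g L gamma y z x
    L_gt0 gamma_gt0 f_diff f_lip g_proper dr0 t.
  by apply: dist0_le sS _; apply: le_trans sB _; rewrite ler_pM2l.
have [|||||||||rate0 rate_lin rate_sub] := kl_descent_rates a
  (c * (2 * gamma^-1 * (1 + gamma * L))) theta rho
  (fun t => enorm (y t - ys)) (fun t => merit t - lim_merit)
  (fun t => enorm (y t.+1 - y t)) 1 _ _ theta_ge0 theta_lt1 rho0.
- by rewrite /a mulr_gt0 ?invr_gt0//; lra.
- by rewrite !mulr_gt0// invr_gt0.
- by move=> t; exact: enorm_ge0.
- move=> t t1; rewrite subr_ge0.
  exact: (lim_merit_le f g L l gamma y z x ys zs xs).
- move=> t t1; have := merit_decr f g L l gamma y z x L_gt0 gamma_gt0 f_diff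
    f_lip f_cvx g_proper dr0 t t1.
  by rewrite -/a -/(merit _) -/(merit _); lra.
- exact: (merit_small f g L l gamma y z x ys zs xs).
- move=> t _; rewrite (_ : y t.+1 - ys = (y t - ys) + (y t.+1 - y t)).
    exact: enorm_triangle.
  by apply/rowP => i; rewrite !mxE; ring.
- by move=> e N e0; have [t Nt [yt _ _]] := clust' e N e0; exists t.
- exact: klt.
split=> [/rate0[N dN]|/rate_lin[eta [kappa [/andP[eta0 eta1] k0 [N dN]]]]|].
- exists N.+1; split=> // t Nt; have := dN t (ltnW Nt).
  case: t Nt => // t _ d0; have [s sS] := stationarity_residual f g L gamma y z x
    L_gt0 gamma_gt0 f_diff f_lip g_proper dr0 t.
  rewrite d0 mulr0 => s0; suff <- : s = 0 by [].
  by apply/eqP; rewrite -enorm_eq0 eq_le s0 enorm_ge0.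
- exists eta, (B * kappa); split=> //; first by rewrite mulr_gt0.
  exists N.+1 => // t /= Nt; rewrite -mulrA; apply: dist_le; first by case: t Nt.
  exact: dN (ltnW Nt).
- move=> /rate_sub[kappa k0 [N dN]]; exists (B * kappa); split.
    by rewrite mulr_gt0.
  exists N.+1 => // t /= Nt; rewrite -mulrA; apply: dist_le; first by case: t Nt.
  exact: dN (ltnW Nt).
Qed.
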